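(* Let $\phi=\frac{1+\sqrt5}{2}$. There is a constant $C>0$ such that every P-position $(x,y)$ of Maharaja Nim with $y\ge x$ satisfies $|y-\phi x|\le C$. (Equivalently, every P-position of Maharaja Nim lies within bounded distance of one of the lines $y=\phi x$ or $y=\phi^{-1}x$.)
   Context: Maharaja Nim is the two-player impartial game played on positions $(x,y)\in\mathbb{N}_0\times\mathbb{N}_0$ ($\mathbb{N}_0$ the non-negative integers). From $(x,y)$ a move goes to any of: $(x-k,y)$, $(x,y-k)$, $(x-k,y-k)$ for an integer $k\ge1$ (Wythoff Nim / Queen moves), or $(x-1,y-2)$, $(x-2,y-1)$ (Knight moves), provided the resulting coordinates are non-negative. Players alternate; the player who moves to $(0,0)$ wins (equivalently, a player with no move loses). A position is a P-position if the second player (the player not about to move) has a winning strategy, and an N-position otherwise. *)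

(* Defs.v *)
From mathcomp Require Import all_boot all_order all_algebra.
From mathcomp Require Import reals.
Set Implicit Arguments.
Unset Strict Implicit.
Unset Printing Implicit Defensive.
Import Order.TTheory GRing.Theory Num.Theory.

Definition position : Type := (nat * nat)%type.

(* Subtraction on nat truncates at 0, hence the upper bounds that keep the
   resulting coordinates non-negative. *)
Inductive maharaja_move : position -> position -> Prop :=
| QueenX x y k : 1 <= k -> k <= x -> maharaja_move (x, y) (x - k, y)
| QueenY x y k : 1 <= k -> k <= y -> maharaja_move (x, y) (x, y - k)
| QueenDiag x y k : 1 <= k -> k <= x -> k <= y ->
    maharaja_move (x, y) (x - k, y - k)
| Knight12 x y : 1 <= x -> 2 <= y -> maharaja_move (x, y) (x - 1, y - 2)
| Knight21 x y : 2 <= x -> 1 <= y -> maharaja_move (x, y) (x - 2, y - 1).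

(* [reached s p b q]: some play from p, in which the second player always moves
   from r to s r, arrives at q; b tells whether it is then the second player's
   turn. *)
Inductive reached (s : position -> position) (p : position) :
    bool -> position -> Prop :=
| ReachedStart : reached s p false p
| ReachedFirst q r :
    reached s p false q -> maharaja_move q r -> reached s p true r
| ReachedSecond q :
    reached s p true q -> maharaja_move q (s q) -> reached s p false (s q).

(* A player without a move loses, and no play is infinite since every move
   lowers x + y. So the second player wins all plays in which she follows s
   exactly when s always gives her a legal move. *)
Definition second_winning_strategy (p : position) (s : position -> position) :=
  forall q, reached s p true q -> maharaja_move q (s q).

Definition P_position (p : position) : Prop :=
  exists s, second_winning_strategy p s.

Definition golden_ratio (R : realType) : R := ((1 + Num.sqrt 5) / 2)%R.

(* Main.v *)
(* By symmetry, [x] is called open if no P-position [(x', x)] has [x' < x]. The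
   P-positions [(x, y)] with [y >= x] are found column by column: closed columns
   have none, and in an open one [y] is the least row such that the row, the
   diagonal and the two knight moves avoid the earlier P-positions. Let [m] be
   the least diagonal not yet used. The used diagonals above [m], the used rows
   above [x + m] and the last two columns make up the state of a transducer that
   reads the status of line [x] and writes that of the lines from [x + m] on. As
   long as no five consecutive closed lines are read, it has finitely many states
   and writes no five consecutive closed lines; this is checked by computation
   and propagates itself because the transducer reads its own output. Hence [y]
   is [x + A(x) + O(1)], where [A(x)] counts the open lines below [x], and
   counting the used rows gives [A(x + A(x)) = x + O(1)]. With [p = 1 / phi],
   the error [f(x) = A(x) - p x] then satisfies [f(x + A(x)) = - p f(x) + O(1)],
   a contraction, so that [f] is bounded and [y = (1 + p) x + O(1) = phi x + O(1)]. *)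
Require Import Defs.
From mathcomp Require Import all_boot all_order all_algebra.
From mathcomp Require Import reals.
From mathcomp Require Import zify ring lra.
Import Order.TTheory GRing.Theory Num.Theory.
Local Open Scope ring_scope.

(** * Outcomes by recursion, and the symmetry and uniqueness of cold positions *)

Section Outcome.
Local Open Scope nat_scope.

Definition options (p : position) : seq position :=
  let: (x, y) := p in
  [seq (x - k, y) | k <- iota 1 x] ++ [seq (x, y - k) | k <- iota 1 y] ++
  [seq (x - k, y - k) | k <- iota 1 (minn x y)] ++
  [seq q <- [:: (x - 1, y - 2)] | (0 < x) && (1 < y)] ++
  [seq q <- [:: (x - 2, y - 1)] | (1 < x) && (0 < y)].

Lemma optionsP (p q : position) : reflect (maharaja_move p q) (q \in options p).
Proof.
apply: (iffP idP) => [|pq].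
  case: p => x y; rewrite /options !mem_cat !mem_filter !inE => /orP[|/orP[|/orP[|/orP[|]]]].
  + by case/mapP => k; rewrite mem_iota => /andP[k1 kx] ->; constructor; lia.
  + by case/mapP => k; rewrite mem_iota => /andP[k1 kx] ->; constructor; lia.
  + by case/mapP => k; rewrite mem_iota => /andP[k1 kx] ->; constructor; lia.
  + by case/andP=> /andP[x0 y1] /eqP ->; constructor.
  + by case/andP=> /andP[x0 y1] /eqP ->; constructor.
case: pq => x y.
- move=> k k1 kx; rewrite mem_cat; apply/orP; left.
  by apply/mapP; exists k; rewrite // mem_iota; lia.
- move=> k k1 kx; rewrite !mem_cat; apply/orP; right; apply/orP; left.
  by apply/mapP; exists k; rewrite // mem_iota; lia.
- move=> k k1 kx ky; rewrite !mem_cat.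
  apply/orP; right; apply/orP; right; apply/orP; left.
  by apply/mapP; exists k; rewrite // mem_iota; lia.
- by move=> x1 y2; rewrite /options !mem_cat !mem_filter !inE x1 y2 eqxx !orbT.
- by move=> x1 y2; rewrite /options !mem_cat !mem_filter !inE x1 y2 eqxx !orbT.
Qed.

Lemma move_lt (p q : position) : maharaja_move p q -> q.1 + q.2 < p.1 + p.2.
Proof. by case=> x y /=; lia. Qed.

(** The fuel makes the recursion structural. Fuel 0 suffices only at the origin, and [p.1 + p.2]
    always does, since every move lowers the sum. *)
Fixpoint coldn (n : nat) (p : position) : bool :=
  if n is n'.+1 then all (fun q => ~~ coldn n' q) (options p) else true.

Definition cold (p : position) : bool := coldn (p.1 + p.2) p.

Lemma coldn_stable (n : nat) (p : position) :
  p.1 + p.2 <= n -> coldn n p = cold p.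
Proof.
suff stable m k q : q.1 + q.2 <= m -> q.1 + q.2 <= k -> coldn m q = coldn k q.
  by move=> pn; apply: stable.
elim: m k q => [|m IHm] [|k] q //=.
- by case: q => [[|x] [|y]].
- by case: q => [[|x] [|y]].
- move=> qm qk; apply: eq_in_all => r /optionsP /move_lt rq.
  by rewrite (IHm k) //; lia.
Qed.

Lemma coldP (p : position) :
  reflect (forall q, maharaja_move p q -> ~~ cold q) (cold p).
Proof.
have -> : cold p = all (fun q => ~~ cold q) (options p).
  rewrite -(@coldn_stable (p.1 + p.2).+1) //=.
  by apply: eq_in_all => q /optionsP /move_lt qp; rewrite coldn_stable // ltnW.
by apply: (iffP allP) => h q /optionsP /h.
Qed.

Lemma cold_exclusive (p q : position) : cold p -> maharaja_move p q -> ~~ cold q.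
Proof. by move/coldP; apply. Qed.

(** If an option [q] were cold, the reply [s q] would not be; yet [s] still wins from [s q], because
    plays from there continue plays from [p]. *)
Lemma P_position_cold (p : position) : P_position p -> cold p.
Proof.
have [n] := ubnP (p.1 + p.2); elim: n p => // n IHn p pn [s winning].
apply/coldP => q pq; apply/negP => cq.
have q_reached := ReachedFirst (ReachedStart s p) pq.
have q_sq := winning _ q_reached.
have /negP := cold_exclusive _ _ cq q_sq; apply; apply: IHn.
  by have := move_lt _ _ pq; have := move_lt _ _ q_sq; lia.
exists s => r r_reached; apply: winning; move: r_reached.
elim=> [|u v _ IH uv|u _ IH us].
- exact: ReachedSecond.
- exact: ReachedFirst IH uv.
- exact: ReachedSecond.
Qed.

Lemma move_swap (x y x' y' : nat) :
  maharaja_move (x, y) (x', y') -> maharaja_move (y, x) (y', x').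
Proof.
move E: (x, y) => p; move E': (x', y') => q pq.
by case: pq E E' =>
  [????? [-> ->] [-> ->]|????? [-> ->] [-> ->]|?????? [-> ->] [-> ->]
  |???? [-> ->] [-> ->]|???? [-> ->] [-> ->]]; constructor.
Qed.

Lemma cold_swap (x y : nat) : cold (x, y) = cold (y, x).
Proof.
have [n] := ubnP (x + y); elim: n x y => // n IHn x y xyn.
apply/coldP/coldP => h [x' y'] m.
- by have /= := move_lt _ _ m => ?; rewrite -IHn ?h //; [exact: move_swap|lia].
- by have /= := move_lt _ _ m => ?; rewrite IHn ?h //; [exact: move_swap|lia].
Qed.

Lemma cold_column (x y y' : nat) : cold (x, y) -> cold (x, y') -> y = y'.
Proof.
wlog lt_yy' : y y' / y < y' => [hw|] c c'.
  by case: (ltngtP y y') => // /hw h; [exact: h|exact/esym/h].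
have := cold_exclusive _ _ c' (@QueenY x y' (y' - y) _ _).
by rewrite subKn ?(ltnW lt_yy') // c; move=> h; suff: false by []; apply: h; lia.
Qed.

Lemma cold_row (x x' y : nat) : cold (x, y) -> cold (x', y) -> x = x'.
Proof. by rewrite !(cold_swap _ y); exact: cold_column. Qed.

Lemma cold_diagonal (x x' d : nat) : cold (x, x + d) -> cold (x', x' + d) -> x = x'.
Proof.
wlog lt_xx' : x x' / x < x' => [hw|] c c'.
  by case: (ltngtP x x') => // /hw h; [exact: h|exact/esym/h].
have := cold_exclusive _ _ c' (@QueenDiag x' (x' + d) (x' - x) _ _ _).
have -> : x' + d - (x' - x) = x + d by lia.
by rewrite subKn ?(ltnW lt_xx') // c; move=> h; suff: false by []; apply: h; lia.
Qed.

End Outcome.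

(** * Used diagonals, used rows and open lines *)

Section Columns.
Local Open Scope nat_scope.

Fixpoint used_diagonal (x d : nat) : bool :=
  if x is x'.+1 then used_diagonal x' d || cold (x', x' + d) else false.

Fixpoint used_row (x y : nat) : bool :=
  if x is x'.+1 then used_row x' y || cold (x', y) else false.

Lemma used_diagonalP (x d : nat) :
  reflect (exists2 x', x' < x & cold (x', x' + d)) (used_diagonal x d).
Proof.
elim: x => [|x IHx] /=; first by constructor; case.
apply: (iffP orP) => [[/IHx[x' lt_x'x]|]|[x']].
- by exists x'; rewrite // ltnW.
- by exists x.
- rewrite ltnS leq_eqVlt => /orP[/eqP -> ? | lt_x'x ?]; first by right.
  by left; apply/IHx; exists x'.
Qed.

Lemma used_rowP (x y : nat) :
  reflect (exists2 x', x' < x & cold (x', y)) (used_row x y).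
Proof.
elim: x => [|x IHx] /=; first by constructor; case.
apply: (iffP orP) => [[/IHx[x' lt_x'x]|]|[x']].
- by exists x'; rewrite // ltnW.
- by exists x.
- rewrite ltnS leq_eqVlt => /orP[/eqP -> ? | lt_x'x ?]; first by right.
  by left; apply/IHx; exists x'.
Qed.

Definition open_line (x : nat) : bool := ~~ used_row x x.

Lemma cold_open_line (x y : nat) : x <= y -> cold (x, y) -> open_line x.
Proof.
move=> xy c; apply/used_rowP => -[x' lt_x'x]; rewrite cold_swap => c'.
by have := cold_column _ _ _ c c'; lia.
Qed.

(** * The transducer on finite bit windows, read as [false] beyond their ends *)

Fixpoint bor (s t : bitseq) : bitseq :=
  match s, t with
  | a :: s', b :: t' => (a || b) :: bor s' t'
  | [::], _ => t
  | _, [::] => s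
  end.

Lemma nth_bor (s t : bitseq) (i : nat) :
  nth false (bor s t) i = nth false s i || nth false t i.
Proof.
elim: s t i => [|a s IHs] [|b t] [|i] //=; rewrite ?orbF ?IHs ?nth_nil ?orbF //.
Qed.

Lemma nth_index_false (s : bitseq) : nth false s (index false s) = false.
Proof.
have [?|?] := boolP (false \in s); first exact: nth_index.
by rewrite nth_default // memNindex.
Qed.

Lemma nth_before_index_false (s : bitseq) (j : nat) :
  j < index false s -> nth false s j.
Proof. by move/(before_find false) => /=; case: nth. Qed.

(** In order: used diagonals from [m] on, used rows from [x + m] on, and the rows from [x + m] on
    that are attacked by a knight from columns [x.-1] and [x.-2]. *)
Definition windows : Type := (bitseq * bitseq * bitseq * bitseq)%type.

Definition chosen (s : windows) : nat :=
  let: (U, V, K1, K2) := s in index false (bor (bor U V) (bor K1 K2)).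

(** In column [x], diagonal [m + e] meets row [x + m + e], so one mark serves both windows. *)
Definition mark (s : windows) (b : bool) : bitseq :=
  if b then rcons (nseq (chosen s) false) true else [::].

Definition advance (s : windows) (b : bool) : nat :=
  index false (bor s.1.1.1 (mark s b)).

(** Diagonals shift by [k] and rows by [k.+1], as [x] grows too. The prepended [false] and the
    [k.+2] combine this shift with the row offsets 2 and 1 of the knight moves. *)
Definition next (s : windows) (b : bool) : windows :=
  let: (U, V, K1, K2) := s in
  let k := advance s b in
  (drop k (bor U (mark s b)), drop k.+1 (bor V (mark s b)),
   drop k (false :: mark s b), drop k.+2 K1).

Definition emitted (s : windows) (b : bool) : bitseq :=
  mkseq (fun j => ~~ nth false (bor s.1.1.2 (mark s b)) j) (advance s b).+1.

Record tracks (x m : nat) (s : windows) : Prop := Tracks {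
  tracks_full d : d < m -> used_diagonal x d;
  tracks_diagonal e : nth false s.1.1.1 e = used_diagonal x (m + e);
  tracks_row e : nth false s.1.1.2 e = used_row x (x + m + e);
  tracks_knight12 e : nth false s.1.2 e = cold (x.-1, (x + m + e).-2);
  tracks_knight21 e : nth false s.2 e = (1 < x) && cold (x.-2, (x + m + e).-1)
}.

Lemma nth_mark (s : windows) (b : bool) (e : nat) :
  nth false (mark s b) e = b && (e == chosen s).
Proof.
rewrite /mark; case: b; last by rewrite nth_nil.
by rewrite nth_rcons size_nseq nth_nseq; case: ltngtP.
Qed.

Lemma blocked_diagonal (x d : nat) : used_diagonal x d -> ~~ cold (x, x + d).
Proof.
move=> /used_diagonalP[x' lt_x'x c']; apply/negP => c.
by have := cold_diagonal _ _ _ c c'; lia.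
Qed.

Lemma blocked_row (x y : nat) : used_row x y -> ~~ cold (x, y).
Proof.
move=> /used_rowP[x' lt_x'x c']; apply/negP => c.
by have := cold_row _ _ _ c c'; lia.
Qed.

Lemma blocked_knight12 (x y : nat) :
  0 < x -> 1 < y -> cold (x.-1, y.-2) -> ~~ cold (x, y).
Proof.
move=> x0 y1 c'; apply/negP => c.
have := cold_exclusive _ _ c (@Knight12 x y _ _).
by rewrite subn1 subn2 c' => h; suff: false by []; apply: h.
Qed.

Lemma blocked_knight21 (x y : nat) :
  0 < y -> (1 < x) && cold (x.-2, y.-1) -> ~~ cold (x, y).
Proof.
move=> y1 /andP[x_gt1 c']; apply/negP => c.
have := cold_exclusive _ _ c (@Knight21 x y _ _).
by rewrite subn1 subn2 c' => h; suff: false by []; apply: h.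
Qed.

(** * Correctness of one step of the transducer *)

Section Step.
Variables (x m : nat) (s : windows).
Hypotheses (x_gt0 : 0 < x) (m_gt0 : 0 < m) (s_tracks : tracks x m s).

Lemma blockedE (e : nat) :
  nth false (bor (bor s.1.1.1 s.1.1.2) (bor s.1.2 s.2)) e =
  [|| used_diagonal x (m + e), used_row x (x + m + e),
      cold (x.-1, (x + m + e).-2) | (1 < x) && cold (x.-2, (x + m + e).-1)].
Proof.
by case: s_tracks => _ HU HV H1 H2; rewrite !nth_bor HU HV H1 H2 -!orbA.
Qed.

Lemma chosenE : chosen s = index false (bor (bor s.1.1.1 s.1.1.2) (bor s.1.2 s.2)).
Proof. by case: s => [[[U V] K1] K2]. Qed.

Lemma not_cold_below (d : nat) : d < m + chosen s -> ~~ cold (x, x + d).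
Proof.
case: (ltnP d m) => [dm _|md].
  by apply: blocked_diagonal; exact: (tracks_full _ _ _ s_tracks).
rewrite -(subnKC md) ltn_add2l chosenE addnA => /nth_before_index_false.
rewrite blockedE; case/or4P.
- by rewrite -addnA; exact: blocked_diagonal.
- exact: blocked_row.
- by apply: blocked_knight12; lia.
- by apply: blocked_knight21; lia.
Qed.

Lemma cold_chosen : open_line x -> cold (x, x + (m + chosen s)).
Proof.
move=> x_open; have := nth_index_false (bor (bor s.1.1.1 s.1.1.2) (bor s.1.2 s.2)).
rewrite -chosenE blockedE => /negbT.
rewrite !negb_or => /and4P[nU nV nK1 nK2].
apply/coldP => q; move E: (x, _) => p pq; case: pq E => a b.
- move=> k k1 kx [? ?]; subst a b; apply: contra nV => c.
  by rewrite -addnA; apply/used_rowP; exists (x - k) => //; lia.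
(* A vertical move ends on a lower diagonal of the same column or in a row [y < x]; there a cold
   position would, by symmetry, close line [x]. *)
- move=> k k1 ky [? ?]; subst a b; set y := _ - k.
  have [y_lt_x|x_le_y] := ltnP y x.
    by apply: contra x_open; rewrite cold_swap => c; apply/used_rowP; exists y.
  by rewrite -(subnKC x_le_y); apply: not_cold_below; lia.
- move=> k k1 kx ky [? ?]; subst a b; apply: contra nU => c.
  apply/used_diagonalP; exists (x - k); first by lia.
  by have -> : x - k + (m + chosen s) = x + (m + chosen s) - k by lia.
- by move=> ? ? [? ?]; subst a b; rewrite subn1 subn2 addnA.
- by move=> x1 ? [? ?]; subst a b; rewrite subn1 subn2 addnA; rewrite x1 in nK2.
Qed.

Lemma cold_columnE (d : nat) : cold (x, x + d) = open_line x && (d == m + chosen s).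
Proof.
apply/idP/andP => [c|[x_open /eqP ->]]; last exact: cold_chosen.
have x_open : open_line x by apply: cold_open_line c; lia.
by have := cold_column _ _ _ c (cold_chosen x_open); split=> //; lia.
Qed.

Let b := open_line x.
Let k := advance s b.

Lemma nth_markE (e : nat) : nth false (mark s b) e = cold (x, x + m + e).
Proof. by rewrite nth_mark -addnA cold_columnE eqn_add2l. Qed.

Lemma diagonal_window (e : nat) :
  nth false (bor s.1.1.1 (mark s b)) e = used_diagonal x.+1 (m + e).
Proof. by rewrite nth_bor nth_markE (tracks_diagonal _ _ _ s_tracks) -addnA. Qed.

Lemma row_window (e : nat) :
  nth false (bor s.1.1.2 (mark s b)) e = used_row x.+1 (x + m + e).
Proof. by rewrite nth_bor nth_markE (tracks_row _ _ _ s_tracks). Qed.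

Lemma full_next (d : nat) : d < m + k -> used_diagonal x.+1 d.
Proof.
have [dm _|md] := ltnP d m; first by rewrite /= (tracks_full _ _ _ s_tracks _ dm).
by rewrite -(subnKC md) ltn_add2l -diagonal_window => /nth_before_index_false.
Qed.

Lemma tracks_next : tracks x.+1 (m + k) (next s b).
Proof.
have -> : next s b =
  (drop k (bor s.1.1.1 (mark s b)), drop k.+1 (bor s.1.1.2 (mark s b)),
   drop k (false :: mark s b), drop k.+2 s.1.2).
  by rewrite /k; case: (s) => [[[U V] K1] K2].
split=> [d|e|e|e|e] /=.
- exact: full_next.
- by rewrite nth_drop diagonal_window addnA.
- by rewrite nth_drop row_window; congr used_row; lia.
- rewrite nth_drop; case E: (k + e) => [|j] /=.
    (* The prepended [false] stands for [(x, x + m.-1)], which lies on a used diagonal. *)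
    apply/esym/negbTE; have -> : (x.+1 + (m + k) + e).-2 = x + m.-1 by lia.
    by apply: not_cold_below; lia.
  by rewrite nth_markE; congr (cold (_, _)); lia.
- rewrite nth_drop (tracks_knight12 _ _ _ s_tracks) ltnS x_gt0 /=.
  by congr (cold (_, _)); lia.
Qed.

(* Later columns reach a row below [x.+1 + m + k] only on the diagonals below
   [m + k], which are all used, so the status of these rows is settled. *)
Lemma open_emitted (j : nat) :
  j <= k -> open_line (x + m + j) = nth false (emitted s b) j.
Proof.
move=> jk; rewrite nth_mkseq ?ltnS // row_window; congr negb.
apply/used_rowP/used_rowP => -[x' lt_x' c].
  have [?|x_lt] := ltnP x' x.+1; first by exists x'.
  have d_full : x + m + j - x' < m + k by lia.
  have /used_diagonalP[x'' lt_x'' c''] := full_next _ d_full.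
  rewrite -(@subnKC x' (x + m + j)) in c; last by lia.
  by have := cold_diagonal _ _ _ c c''; lia.
by exists x' => //; lia.
Qed.

End Step.

(** * Counting open lines and runs of closed lines *)

Fixpoint opens (x : nat) : nat :=
  if x is x'.+1 then open_line x' + opens x' else 0.

Definition run (c : nat) (b : bool) : nat := if b then 0 else c.+1.

Fixpoint closed_run (x : nat) : nat :=
  if x is x'.+1 then run (closed_run x') (open_line x') else 0.

Definition spells (y : nat) (s : bitseq) : Prop :=
  forall j, j < size s -> open_line (y + j) = nth false s j.

Lemma spells_cons (y : nat) (b : bool) (s : bitseq) :
  spells y (b :: s) -> open_line y = b /\ spells y.+1 s.
Proof.
move=> h; split=> [|j js]; first by have := h 0 isT; rewrite addn0.
by rewrite addSnnS (h j.+1).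
Qed.

Lemma opens_spells (y : nat) (s : bitseq) :
  spells y s -> opens (y + size s) = opens y + count id s.
Proof.
elim: s y => [|b s IHs] y; first by rewrite !addn0.
by case/spells_cons=> yb /IHs h; rewrite -[size _]/(size s).+1 -addSnnS h /= yb; lia.
Qed.

Lemma closed_run_spells (y : nat) (s : bitseq) :
  spells y s -> closed_run (y + size s) = foldl run (closed_run y) s.
Proof.
elim: s y => [|b s IHs] y; first by rewrite addn0.
by case/spells_cons=> yb /IHs h; rewrite -[size _]/(size s).+1 -addSnnS h /= yb.
Qed.

Definition short (c : nat) (s : bitseq) : bool := all (leq^~ 4) (scanl run c s).

Lemma closed_run_short (y : nat) (s : bitseq) :
  spells y s -> short (closed_run y) s ->
  forall i, y < i <= y + size s -> closed_run i <= 4.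
Proof.
elim: s y => [|b s IHs] y; first by move=> _ _ i /=; lia.
case/spells_cons=> yb sp; rewrite /short /= => /andP[c4 cs] i /andP[yi iy].
have [->|ne_i] := eqVneq i y.+1; first by rewrite /= yb.
by apply: (IHs y.+1) => //; [rewrite /= yb | lia].
Qed.

Lemma count_bor (s t : bitseq) : (forall i, ~~ (nth false s i && nth false t i)) ->
  count id (bor s t) = count id s + count id t.
Proof.
elim: s t => [|a s IHs] [|b t] //= st; first by rewrite addn0.
rewrite IHs => [|i]; last exact: (st i.+1).
by have := st 0; case: a {st}; case: b => //=; lia.
Qed.

Lemma count_mark (s : windows) (b : bool) : count id (mark s b) = b.
Proof. by case: b; rewrite //= -cats1 count_cat count_nseq. Qed.

Lemma count_mkseq_drop (s : bitseq) (n : nat) :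
  count id s = count id (mkseq (nth false s) n) + count id (drop n s).
Proof.
elim: s n => [|a s IHs] n.
  rewrite addn0 /mkseq count_map [RHS](eq_count (a2 := pred0)) ?count_pred0 // => i.
  by rewrite /= nth_nil.
case: n => [|n] //=.
by rewrite (IHs n) /mkseq /= (iotaDl 1 0 n) -map_comp addnA.
Qed.

(* [(c, s, c')] records, with reading position [x] and writing position [x + m],
   the lengths of the runs of closed lines just before these two positions. *)
Definition state : Type := (nat * windows * nat)%type.

Definition step (t : state) (b : bool) : state :=
  let: (c, s, c') := t in (run c b, next s b, foldl run c' (emitted s b)).

(** A fifth consecutive closed line is never read. *)
Definition readable (t : state) : bitseq :=
  [seq b <- [:: true; false] | b || (t.1.1 < 4)].

(** * Exhaustive check of the reachable states *)

Fixpoint explore (fuel : nat) (frontier seen : seq state) : seq state :=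
  if fuel is fuel'.+1 then
    let new := undup [seq t <- flatten [seq map (step t) (readable t) | t <- frontier]
                     | t \notin seen] in
    if new is [::] then seen else explore fuel' new (new ++ seen)
  else seen.

(** The state at [x = m = 1]: the only earlier cold position is [(0, 0)], and the set bit is its
    knight attack on [(1, 2)]. *)
Definition start : state := (0, ([::], [::], [:: true], [::]), 0).

Inductive reachable : state -> Prop :=
| ReachableStart : reachable start
| ReachableStep t b : reachable t -> b \in readable t -> reachable (step t b).

Definition safe (t : state) : bool :=
  let: (_, s, c') := t in
  [&& size s.1.1.1 <= 20, size s.1.1.2 <= 20, chosen s <= 20 &
      all (fun b => short c' (emitted s b) && (advance s b <= 20)) (readable t)].

(* If no five consecutive lines that are read are closed, the machine is finite
   and no five consecutive lines that it writes are closed. *)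
Lemma reachable_safe (t : state) : reachable t -> safe t.
Proof.
have [S /and3P[S0 /allP Sstep /allP Ssafe]] : exists S,
    [&& start \in S, all (fun t => all (fun b => step t b \in S) (readable t)) S
      & all safe S].
  (* The search only proposes [S]; membership of [start], closure under [step] and safety are then
     checked on [S] itself. *)
  by exists (explore 1000 [:: start] [:: start]); vm_compute.
move=> t_reachable; apply: Ssafe; elim: t_reachable => [//|{}t b _ tS b_t].
exact: (allP (Sstep t tS)).
Qed.

(** * The invariant linking columns to transducer states *)

Record invariant (x m : nat) (t : state) : Prop := Invariant {
  inv_x : 0 < x;
  inv_m : 0 < m;
  inv_tracks : tracks x m t.1.2;
  inv_read : closed_run x = t.1.1;
  inv_written : closed_run (x + m) = t.2;
  inv_short i : i <= x + m -> closed_run i <= 4;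
  inv_reachable : reachable t;
  inv_diagonals : opens x = m + count id t.1.2.1.1.1;
  inv_rows : opens (x + m) + opens x = x + m + 1 + count id t.1.2.1.1.2
}.

Lemma invariant_start : invariant 1 1 start.
Proof.
have cold0 y : cold (0, y.+1) = false.
  by apply/negbTE/negP => /(cold_column 0 0 _ isT).
split=> //.
- split=> [[|//]|e|e|[|e]|e] //=; rewrite ?nth_nil //; exact/esym/cold0.
- by case=> [|[|[|]]].
- exact: ReachableStart.
Qed.

Lemma invariant_step (x m : nat) (t : state) : invariant x m t ->
  exists t', exists2 k, k <= 20 & invariant x.+1 (m + k) t'.
Proof.
case: t => -[c s] c' [/= x0 m0 tr rd wr sh re dg rw].
set b := open_line x; set k := advance s b.
(* As [m > 0], the run bound already covers line [x]: the transducer reads its own earlier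
   output. *)
have b_readable : b \in readable (c, s, c').
  rewrite mem_filter /= -rd; apply/andP; split; last by case: (b).
  have := sh x.+1; rewrite /= -/b /run; case: (b) => //= h.
  by apply: h; lia.
have /and4P[_ _ _ /allP /(_ b b_readable) /andP[sh' k20]] := reachable_safe _ re.
have sp : spells (x + m) (emitted s b).
  move=> j; rewrite size_mkseq ltnS => jk.
  exact: open_emitted.
have size_em : size (emitted s b) = k.+1 by rewrite size_mkseq.
have end_em : x.+1 + (m + k) = x + m + size (emitted s b) by rewrite size_em; lia.
exists (step (c, s, c') b), k => //.
have stepE : (step (c, s, c') b).1.2 = next s b by [].
have U_marked i : ~~ (nth false s.1.1.1 i && nth false (mark s b) i).
  rewrite (tracks_diagonal _ _ _ tr) (nth_markE _ _ _ x0 m0 tr) -addnA.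
  by apply/negP => /andP[/blocked_diagonal /negbTE ->].
have V_marked i : ~~ (nth false s.1.1.2 i && nth false (mark s b) i).
  rewrite (tracks_row _ _ _ tr) (nth_markE _ _ _ x0 m0 tr).
  by apply/negP => /andP[/blocked_row /negbTE ->].
have U_next : (next s b).1.1.1 = drop k (bor s.1.1.1 (mark s b)).
  by rewrite /k; case: (s) => [[[U V] K1] K2].
have V_next : (next s b).1.1.2 = drop k.+1 (bor s.1.1.2 (mark s b)).
  by rewrite /k; case: (s) => [[[U V] K1] K2].
split.
- by [].
- by rewrite addn_gt0 m0.
- exact: tracks_next.
- by rewrite /= rd.
- by rewrite end_em closed_run_spells // wr.
- rewrite end_em => i i_le; have [?|i_gt] := leqP i (x + m); first exact: sh.
  by apply: (closed_run_short _ _ sp); rewrite ?wr // i_gt.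
- exact: ReachableStep.
- rewrite stepE U_next /= -/b dg.
  have := count_mkseq_drop (bor s.1.1.1 (mark s b)) k.
  rewrite count_bor // count_mark.
  have -> : count id (mkseq (nth false (bor s.1.1.1 (mark s b))) k) = k.
    rewrite -[RHS](size_mkseq (nth false (bor s.1.1.1 (mark s b)))).
    apply/eqP; rewrite -all_count; apply/allP => a /mapP[j].
    by rewrite mem_iota => /andP[_ jk] ->; apply: nth_before_index_false.
  by lia.
- rewrite end_em opens_spells // size_em stepE V_next [opens x.+1]/= -/b.
  have := count_mkseq_drop (bor s.1.1.2 (mark s b)) k.+1.
  rewrite count_bor // count_mark.
  (* Emitted bits are negated row bits, so open lines and used rows among these [k.+1] lines are
     complementary. *)
  have : count id (emitted s b)
      + count id (mkseq (nth false (bor s.1.1.2 (mark s b))) k.+1) = k.+1.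
    have := count_predC id (mkseq (nth false (bor s.1.1.2 (mark s b))) k.+1).
    by rewrite size_mkseq addnC => h; rewrite -[RHS]h /emitted /mkseq !count_map.
  by lia.
Qed.

Lemma invariant_exists (x : nat) : 0 < x -> exists m t, invariant x m t.
Proof.
elim: x => // -[_ _|x IHx _]; first by exists 1, start; exact: invariant_start.
have [m [t /invariant_step[t' [k _ inv]]]] := IHx isT.
by exists (m + k), t'.
Qed.

(** * Approximate relations satisfied by [opens] *)

Lemma invariant_written (z : nat) : 1 < z ->
  exists x m t, [/\ invariant x m t, x < z & x + m <= z <= x + m + 20].
Proof.
elim: z => // -[//|[_ _|z IHz _]].
  by exists 1, 1, start; split=> //; exact: invariant_start.
have [x [m [t [inv xz /andP[mz zm]]]]] := IHz isT.
(* The writing position moves by [k.+1 <= 21], so its last value up to [z] is at most 20 behind. *)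
have [z_le|z_gt] := leqP z.+3 (x + m + 20).
  by exists x, m, t; split=> //; lia.
have [t' [k k20 inv']] := invariant_step _ _ _ inv.
by exists x.+1, (m + k), t'; split=> //; lia.
Qed.

Lemma inv_bounded (x m : nat) (t : state) : invariant x m t ->
  [/\ count id t.1.2.1.1.1 <= 20, count id t.1.2.1.1.2 <= 20 & chosen t.1.2 <= 20].
Proof.
move=> /inv_reachable /reachable_safe; case: t => -[c s] c' /and4P[sU sV se _].
by split=> //; apply: leq_trans (count_size _ _) _.
Qed.

Lemma opens_diff (x n : nat) : opens x <= opens (x + n) <= opens x + n.
Proof. by elim: n => [|n IHn]; rewrite ?addn0 ?addnS //=; lia. Qed.

(* [opens] is nearly inverse to [x |-> x + opens x]; for Wythoff Nim this is the
   complementarity of the two Beatty sequences. *)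
Lemma opens_recursion (z : nat) : 1 < z -> exists2 x, x < z &
  (z <= x + opens x + 20 /\ x + opens x <= z + 20) /\
  (opens z <= x + 50 /\ x <= opens z + 50).
Proof.
move=> /invariant_written[x [m [t [inv xz /andP[mz zm]]]]]; exists x => //.
have [cU cV _] := inv_bounded _ _ _ inv.
(* Eliminating [m] shows that [opens (x + m)] is [x + 1] plus a difference of two counts, each at
   most 20; passing to [z] adds at most 20. *)
have := inv_diagonals _ _ _ inv; have := inv_rows _ _ _ inv.
have := opens_diff (x + m) (z - (x + m)).
by rewrite subnKC //; lia.
Qed.

(** For [x > 0], [y - x] is [m + chosen] and [opens x] is [m] plus a window count; both excesses
    over [m] are at most 20. *)
Lemma cold_opens (x y : nat) : x <= y -> cold (x, y) ->
  y <= x + opens x + 50 /\ x + opens x <= y + 50.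
Proof.
case: x => [|x] xy c.
  by have <- := cold_column 0 0 y isT c.
have [m [t inv]] := invariant_exists x.+1 isT.
have [cU _ se] := inv_bounded _ _ _ inv.
have := inv_diagonals _ _ _ inv.
move: c; rewrite -(subnKC xy) (cold_columnE _ _ _ _ _ (inv_tracks _ _ _ inv)) //.
  by move=> /andP[_ /eqP]; lia.
exact: inv_m inv.
Qed.

End Columns.

(** * The contraction estimate *)

Theorem mainTheorem1 (R : realType) :
  exists C : R, 0 < C /\
    forall x y : nat, (x <= y)%N -> P_position (x, y) ->
      `|y%:R - golden_ratio R * x%:R| <= C.
Proof.
pose p : R := golden_ratio R - 1.
have sqrt5 : Num.sqrt 5 ^+ 2 = 5 :> R by rewrite sqr_sqrtr.
have sqrt5_ge0 : 0 <= Num.sqrt 5 :> R by exact: sqrtr_ge0.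
have p2 : p ^+ 2 = 1 - p by rewrite /p /golden_ratio; field: sqrt5.
have p_ge0 : 0 <= p by rewrite /p /golden_ratio; nra.
have p_le : p <= 7 / 10 by nra.
(* The bound 1000 reproduces itself, since [7 / 10 * 1000 + 50 + 7 / 10 * 20 <= 1000]. *)
have near z : `|(opens z)%:R - p * z%:R| <= 1000.
  elim/ltn_ind: z => z IHz; have [z_gt1|z_le1] := ltnP 1 z; last first.
    have := opens_diff 0 z; rewrite add0n => /andP[_]; rewrite -(ler_nat R) => opens_le.
    have : (z%:R : R) <= 1 by rewrite (ler_nat R z 1).
    have := ler0n R z; have := ler0n R (opens z).
    move=> opens_ge0 z_ge0 z_le.
    have pz_ge0 : 0 <= p * z%:R by rewrite mulr_ge0.
    have pz_le : p * z%:R <= 1 by apply: mulr_ile1 => //; lra.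
    by rewrite ler_norml; lra.
  have [x xz [[h1 h2] [h3 h4]]] := opens_recursion _ z_gt1.
  have := IHz x xz; move: h1 h2 h3 h4; rewrite -!(ler_nat R) !natrD !ler_norml.
  move: (x%:R) (z%:R) (opens x)%:R (opens z)%:R => X Z A B.
  move=> h1 h2 h3 h4 /andP[h5 h6].
  (* This turns [X - p * (X + A)] into [- p * (A - p * X)]; [m1] to [m4] are the bounds scaled by
     [p], which makes the goal linear. *)
  have ppX : p * (p * X) = X - p * X by rewrite mulrA -expr2 p2; ring.
  have m1 : 0 <= p * (X + A + 20 - Z) by apply: mulr_ge0 => //; lra.
  have m2 : 0 <= p * (Z + 20 - (X + A)) by apply: mulr_ge0 => //; lra.
  have m3 : 0 <= p * (A - p * X + 1000) by apply: mulr_ge0 => //; lra.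
  have m4 : 0 <= p * (1000 - (A - p * X)) by apply: mulr_ge0 => //; lra.
  by lra.
(* The error is [y - x - opens x], at most 50 in absolute value, plus [opens x - p * x], at most
   1000. *)
exists 2000; split=> // x y xy /P_position_cold /(cold_opens _ _ xy)[].
rewrite -!(ler_nat R) !natrD; move: (near x); rewrite !ler_norml.
have -> : golden_ratio R = p + 1 by rewrite /p; ring.
by lra.
Qed.
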